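(* Let $0<\theta<2^{-16}$. There exists $n_0=n_0(\theta)$ such that for every $n\geq n_0$ and every graph $G$ of order $n$ with $\mu(G)>(1/2-\theta)n$, at least one of the following holds: (i) $G$ contains a cycle of length $t$ for every integer $t$ with $3\leq t\leq n/321$; (ii) there exists an induced bipartite subgraph $G_0$ of $G$ with $|G_0|>(1-4\theta^{1/3})n$ and $\delta(G_0)>(1/2-7\theta^{1/3})n$.
   Context: Graphs are finite and simple. $\mu(G)$ denotes the largest eigenvalue of the adjacency matrix of $G$, $|G|$ the number of vertices of $G$, and $\delta(G)$ the minimum degree of $G$. *)

(* Defs.v *)
From HB Require Import structures.
From mathcomp Require Import all_boot all_order all_algebra.
From mathcomp Require Import reals exp.
Set Implicit Arguments. Unset Strict Implicit. Unset Printing Implicit Defensive.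
Import Order.TTheory GRing.Theory Num.Theory.
Local Open Scope ring_scope.

Definition simple_graph (n : nat) (e : rel 'I_n) : Prop :=
  symmetric e /\ irreflexive e.

Definition adjmx (R : realType) (n : nat) (e : rel 'I_n) : 'M[R]_n :=
  \matrix_(i, j) (e i j)%:R.

Definition is_mu (R : realType) (n : nat) (e : rel 'I_n) (mu : R) : Prop :=
  eigenvalue (adjmx R e) mu /\
  (forall l : R, eigenvalue (adjmx R e) l -> l <= mu).

Definition has_cycle_of_length (n : nat) (e : rel 'I_n) (t : nat) : Prop :=
  exists s : seq 'I_n, [/\ size s = t, uniq s & cycle e s].

Definition induced_bipartite (n : nat) (e : rel 'I_n) (S : {set 'I_n}) : Prop :=
  exists A : {set 'I_n}, A \subset S /\
    (forall u v, u \in S -> v \in S -> e u v -> (u \in A) != (v \in A)).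

Definition ind_deg (n : nat) (e : rel 'I_n) (S : {set 'I_n}) (v : 'I_n) : nat :=
  #|[set u in S | e v u]|.

(* Main.v *)
Require Import Defs.
From HB Require Import structures.
From mathcomp Require Import all_boot all_order all_algebra.
From mathcomp Require Import reals exp boolp.
From mathcomp Require Import zify ring lra.
Import Order.TTheory GRing.Theory Num.Theory.
Local Open Scope ring_scope.

(** Suppose that no cycle has length [t], where [3 <= t <= n / 321]. If [ab] is
    an edge, a greedy path alternating between the common neighbours of [a] and
    [b] and arbitrary vertices would close up to a cycle of length [t]; hence
    the degrees of the common neighbours of [a] and [b] (the book of [ab]) sum
    to at most [2 t n].

    Let [y] be the absolute value of an eigenvector for [mu], with sum [Y].
    Adding the eigenvalue inequality over the two ends of every edge gives
    [2 mu^2 Y <= 2 m Y + (total y-weight of the books)], [m] being the number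
    of edges, so [m] is close to [n^2 / 4]. A set [S] maximising
    [2 e(S) - (43/100) |S|^2] then contains most vertices and has large minimum
    degree. A triangle in [S] would produce a large book, so [S] is
    triangle-free, and its minimum degree makes it bipartite. Every triangle of
    the graph now meets the complement of [S], so the books are much lighter
    than first estimated, and the same inequality gives
    [n^2 - |S|^2 = O(theta n^2)]. Maximising once more, over the subsets of
    [S], with [1/2 - 3 theta^(1/3)] in place of [43/100], gives the required
    subgraph. *)

(** * Cycles through books, and subsets of large minimum degree *)

Section Combinatorics.
Context {n : nat} (e : rel 'I_n) (esym : symmetric e) (eirr : irreflexive e).
Implicit Types (S U W X L : {set 'I_n}) (a b v w x : 'I_n).

Definition deg v : nat := ind_deg e setT v.

Definition cnbr a b : {set 'I_n} := [set w | e a w && e b w].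

(* Twice the number of edges induced by [S]. *)
Definition dvol S : nat := \sum_(v in S) ind_deg e S v.

Lemma ind_degE S v : ind_deg e S v = (\sum_(u in S) e v u)%N.
Proof.
rewrite /ind_deg -sum1_card big_mkcond [RHS]big_mkcond /=.
by apply: eq_bigr => u _; rewrite !inE; case: (u \in S); case: (e v u).
Qed.

Lemma leq_ind_deg S U v : S \subset U -> (ind_deg e S v <= ind_deg e U v)%N.
Proof.
move=> sSU; apply/subset_leq_card/subsetP => u; rewrite !inE => /andP[uS ->].
by rewrite (subsetP sSU).
Qed.

(** Vertices with fewer than [t] neighbours on the opposite side are deleted one at a time. Each
    deletion lowers the degree sum by less than [t] and the bound by exactly [t], so the strict
    inequality survives and [W] never becomes empty. The two sides may overlap. *)
Lemma dense_core t W X :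
  (t * (#|W| + #|X|) < \sum_(w in W) ind_deg e X w)%N ->
  exists L Z, [/\ L \subset W, L != set0,
    forall w, w \in L -> (t <= ind_deg e Z w)%N &
    forall x, x \in Z -> (t <= ind_deg e L x)%N].
Proof.
elim: {W X}(#|W| + #|X|)%N {-2}W {-2}X (leqnn (#|W| + #|X|)) => [|k IH] W X leWX ltWX.
  have : #|W| = 0%N by lia.
  by move/cards0_eq=> W0; move: ltWX; rewrite W0 big_set0 ltn0.
have [/existsP[w /andP[wW ltw]]|/existsPn hW] :=
    boolP [exists w, (w \in W) && (ind_deg e X w < t)%N].
  have cW : #|W| = #|W :\ w|.+1 by rewrite (cardsD1 w) wW.
  have [||L [Z [sL L0 hL hZ]]] := IH (W :\ w) X; first by lia.
    have: (\sum_(v in W) ind_deg e X v =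
           ind_deg e X w + \sum_(v in W :\ w) ind_deg e X v)%N.
      by rewrite (big_setD1 _ wW).
    by move: ltWX; rewrite cW addSn mulnS; lia.
  by exists L, Z; split=> //; apply: subset_trans sL (subD1set _ _).
have [/existsP[x /andP[xX ltx]]|/existsPn hX] :=
    boolP [exists x, (x \in X) && (ind_deg e W x < t)%N].
  have cX : #|X| = #|X :\ x|.+1 by rewrite (cardsD1 x) xX.
  have [||L [Z [sL L0 hL hZ]]] := IH W (X :\ x); first by lia.
    have: (\sum_(w in W) ind_deg e X w =
           ind_deg e W x + \sum_(w in W) ind_deg e (X :\ x) w)%N.
      rewrite ind_degE -big_split; apply: eq_bigr => w wW /=.
      by rewrite !ind_degE (big_setD1 x xX) /= (esym w).
    by move: ltWX; rewrite cX addnS mulnS; lia.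
  by exists L, Z.
exists W, X; split=> // [|w wW|x xX].
- by apply/eqP => W0; move: ltWX; rewrite W0 big_set0.
- by have := hW w; rewrite wW -leqNgt.
- by have := hX x; rewrite xX -leqNgt.
Qed.

Lemma fresh_neighbour S v (s : seq 'I_n) :
  (size s < ind_deg e S v)%N -> exists u, [/\ u \in S, e v u & u \notin s].
Proof.
move=> lts; have [/existsP[u /and3P[]]|/existsPn h] :=
    boolP [exists u, [&& u \in S, e v u & u \notin s]]; first by exists u.
have: (ind_deg e S v <= size s)%N.
  apply: leq_trans (card_size s); apply/subset_leq_card/subsetP => u.
  by rewrite !inE => /andP[uS eu]; have := h u; rewrite uS eu /= negbK.
by rewrite leqNgt lts.
Qed.


(** The path grows at its front: each vertex has at least [t] neighbours on the other side, more
    than there are vertices to avoid. *)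
Lemma alternating_path t a b L Z k : e a b ->
  L \subset cnbr a b -> L != set0 ->
  (forall w, w \in L -> (t <= ind_deg e Z w)%N) ->
  (forall x, x \in Z -> (t <= ind_deg e L x)%N) ->
  (k.*2.+2 <= t)%N ->
  exists w s, [/\ path e w s, uniq [:: a, b, w & s], size s = k.*2, w \in L &
    last w s \in L].
Proof.
move=> eab sL /set0Pn[w0 w0L] hL hZ.
have Lab w : w \in L -> [/\ e a w, e b w, a != w & b != w].
  move=> /(subsetP sL); rewrite inE => /andP[ew1 ew2]; split=> //.
    by apply: contraTneq ew1 => ->; rewrite eirr.
  by apply: contraTneq ew2 => ->; rewrite eirr.
have nab : a != b by apply: contraTneq eab => ->; rewrite eirr.
elim: k => [|k IH] lekt.
  exists w0, [::]; split=> //=.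
  by have [_ _ na nb] := Lab _ w0L; rewrite !inE negb_or nab na nb.
have [|w [s [ps us ss wL lL]]] := IH; first by lia.
(* [Z] may contain [a] and [b], so [x] must avoid them explicitly; the vertex [w'] chosen next lies
   in [L] and differs from both because it is adjacent to both. *)
have [|x [xZ ewx xs]] := @fresh_neighbour Z w [:: a, b, w & s].
  by apply: leq_trans (hL _ wL); rewrite /= ss.
have [|w' [w'L exw' w's]] := @fresh_neighbour L x [:: x, w & s].
  by apply: leq_trans (hZ _ xZ); rewrite /= ss ltnW.
have [_ _ na nb] := Lab _ w'L.
exists w', [:: x, w & s]; split; [| |by rewrite /= ss|exact: w'L|exact: lL].
  by rewrite /= (esym w') exw' (esym x) ewx ps.
move: us xs w's; rewrite /= !inE !negb_or.
move=> /and4P[/and3P[_ -> ->] /andP[-> ->] -> ->].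
move=> /and4P[xa xb -> ->] /and3P[-> -> ->].
by rewrite nab na nb (eq_sym a) (eq_sym b) xa xb.
Qed.

(* An alternating path [w_0 x_1 w_1 ... w_k] with all [w_i] adjacent to both
   ends of the edge [ab] closes up to cycles of lengths [2k+2] (through [a])
   and [2k+3] (through [a] and [b]). *)
Lemma cnbr_deg_sum t a b : (3 <= t)%N -> ~ has_cycle_of_length e t -> e a b ->
  (\sum_(w in cnbr a b) deg w <= 2 * t * n)%N.
Proof.
move=> t3 noC eab.
(* The path is used with [k = t.-2./2]; the parity of [t] selects the closing. *)
have tE : (t.-2./2.*2 + odd t).+2 = t.
  by case: (t) t3 => [|[|u]] //= _; rewrite negbK addnC odd_double_half.
rewrite leqNgt; apply/negP => big.
have [|L [Z [sL L0 hL hZ]]] := @dense_core t (cnbr a b) setT.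
  apply: leq_ltn_trans big; rewrite cardsT card_ord -mulnA mulnCA.
  rewrite leq_mul // mul2n -addnn leq_add2r.
  by rewrite -[X in (_ <= X)%N]card_ord max_card.
have Lab w : w \in L -> e a w /\ e b w.
  by move=> /(subsetP sL); rewrite inE => /andP[].
have [|w [s [ps us ss wL lL]]] :=
  @alternating_path t a b L Z (t.-2)./2 eab sL L0 hL hZ.
  by rewrite -[X in (_ <= X)%N]tE !ltnS leq_addr.
apply: noC; have [aw bw] := Lab _ wL; have [al bl] := Lab _ lL.
have [todd|teven] := boolP (odd t).
  exists [:: b, a, w & s]; split.
  - by rewrite /= ss -[RHS]tE todd addn1.
  - move: us; rewrite /= !inE !negb_or eq_sym.
    by move=> /and4P[/and3P[-> -> ->] -> -> ->].
  - by rewrite /= esym eab aw rcons_path ps /= esym bl.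
exists [:: a, w & s]; split.
- by rewrite /= ss -[RHS]tE (negbTE teven) addn0.
- by move: us; rewrite /= !inE !negb_or => /and4P[/and3P[_ -> ->] _ -> ->].
- by rewrite /= aw rcons_path ps /= esym al.
Qed.

Lemma dvolD1 S v : v \in S -> dvol S = (dvol (S :\ v) + 2 * ind_deg e S v)%N.
Proof.
move=> vS; rewrite /dvol (big_setD1 _ vS) /=.
have -> : (\sum_(u in S :\ v) ind_deg e S u =
    \sum_(u in S :\ v) ind_deg e (S :\ v) u + ind_deg e S v)%N.
  have -> : ind_deg e S v = (\sum_(u in S :\ v) e v u)%N.
    by rewrite ind_degE (big_setD1 _ vS) /= eirr.
  rewrite -big_split; apply: eq_bigr => u _ /=.
  by rewrite !ind_degE (big_setD1 _ vS) /= esym addnC.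
by rewrite addnCA addnn mul2n.
Qed.

Lemma dvol_mono S U : S \subset U -> (dvol S <= dvol U)%N.
Proof.
move=> sSU; rewrite /dvol [leqRHS](big_setID S) (setIidPr sSU).
by apply: leq_trans (leq_addr _ _); apply: leq_sum => v _; apply: leq_ind_deg.
Qed.

Lemma dvol_le S : (dvol S <= #|S| ^ 2)%N.
Proof.
rewrite /dvol -mulnn -sum_nat_const; apply: leq_sum => v _.
by apply/subset_leq_card/subsetP => u; rewrite inE => /andP[].
Qed.

(* A maximiser of [dvol S - k |S|^2] has no vertex of small degree. *)
Lemma min_deg_subset (R : realType) (k : R) U :
  exists S, [/\ S \subset U,
    (dvol U)%:R - k * #|U|%:R ^+ 2 <= (dvol S)%:R - k * #|S|%:R ^+ 2 &
    forall v, v \in S -> k * (2 * #|S|%:R - 1) <= 2 * (ind_deg e S v)%:R].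
Proof.
pose f S : R := (dvol S)%:R - k * #|S|%:R ^+ 2.
have [S [sS maxS]] : exists S, S \subset U /\ forall X, X \subset U -> f X <= f S.
  case: (@arg_maxP _ _ _ U (fun S => S \subset U) f (subxx U)) => S sS maxS.
  by exists S; split=> // X; apply: maxS.
exists S; split=> // [|v vS]; first exact: maxS.
have := maxS (S :\ v) (subset_trans (subD1set _ _) sS).
(* Removing [v] lowers [dvol S] by twice the degree of [v] and [|S|^2] by [2|S| - 1]. *)
rewrite /f (dvolD1 _ _ vS) (cardsD1 v S) vS natrD natrM natrD mulr1n.
move: #|_|%:R (ind_deg _ _ _)%:R (dvol _)%:R => x y z h.
lra.
Qed.

End Combinatorics.

(** * Bipartiteness of dense triangle-free graphs *)

Section Bipartite.
Context {n : nat} (e : rel 'I_n) (esym : symmetric e).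
Implicit Types (S U W X L : {set 'I_n}) (a b c v w x : 'I_n).

Lemma card_disjoint3 S W X L :
  W \subset S -> X \subset S -> L \subset S ->
  [disjoint W & X] -> [disjoint W & L] -> [disjoint X & L] ->
  (#|W| + #|X| + #|L| <= #|S|)%N.
Proof.
move=> sW sX sL dWX dWL dXL.
have -> : (#|W| + #|X| + #|L|)%N = #|W :|: X :|: L|.
  rewrite !cardsU.
  have /eqP -> : W :&: X == set0 by rewrite setI_eq0.
  have /eqP -> : (W :|: X) :&: L == set0.
    by rewrite setIUl setU_eq0 !setI_eq0 dWL.
  by rewrite !cards0 !subn0.
by apply: subset_leq_card; rewrite !subUset sW sX sL.
Qed.

(** Fix an edge [ab]. Adjacent vertices have disjoint neighbourhoods, and no neighbourhood meets
    both [N a] and [N b]. The classes are given by whether [N v] misses [N a]; an edge inside a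
    class would yield three pairwise disjoint neighbourhoods, of total size above [9/7 |S|]. *)
Lemma bipartite_of_triangle_free S :
  (forall a b c, a \in S -> b \in S -> c \in S ->
    e a b -> e a c -> e b c -> False) ->
  (forall v, v \in S -> (3 * #|S| < 7 * ind_deg e S v)%N) ->
  induced_bipartite e S.
Proof.
move=> noT hdeg; pose N v := [set u in S | e v u].
have NS v : N v \subset S by apply/subsetP => u; rewrite inE => /andP[].
have Ndeg v : v \in S -> (3 * #|S| < 7 * #|N v|)%N by apply: hdeg.
have dN u v : u \in S -> v \in S -> e u v -> [disjoint N u & N v].
  move=> uS vS euv; rewrite disjoints_subset; apply/subsetP => w.
  rewrite !inE => /andP[wS ew]; rewrite wS /=; apply/negP => ew'.
  by apply: (noT u v w).
have [->|/set0Pn[a aS]] := eqVneq S set0.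
  by exists set0; split=> // u v; rewrite inE.
have [b] : exists b, b \in N a.
  by apply/set0Pn/eqP => Na0; have := Ndeg _ aS; rewrite Na0 cards0 muln0 ltn0.
rewrite inE => /andP[bS eab].
(* Here [3/7] is needed: the parts of [N v] in [N b], in [N a] and outside both are disjoint from
   [N p] and [N a], from [N q] and [N b], and from [N a] and [N b] respectively. Each is thus
   smaller than [|S| / 7], so [|N v| < 3/7 |S|]. *)
have no_mixed v p q : v \in S -> p \in N v :&: N a -> q \in N v :&: N b -> False.
  move=> vS; rewrite inE => /andP[pNv pNa]; rewrite inE => /andP[qNv qNb].
  have [pS evp] : p \in S /\ e v p by move: pNv; rewrite inE => /andP[].
  have [qS evq] : q \in S /\ e v q by move: qNv; rewrite inE => /andP[].
  have eap : e a p by move: pNa; rewrite inE => /andP[].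
  have ebq : e b q by move: qNb; rewrite inE => /andP[].
  have h1 : (#|N p| + #|N a| + #|N v :&: N b| <= #|S|)%N.
    apply: card_disjoint3; rewrite ?NS //.
    - exact: subset_trans (subsetIl _ _) (NS v).
    - by rewrite dN // esym.
    - by apply: disjointWr (subsetIl _ _) _; rewrite dN // esym.
    - by apply: disjointWr (subsetIr _ _) _; rewrite dN.
  have h2 : (#|N q| + #|N b| + #|N v :&: N a| <= #|S|)%N.
    apply: card_disjoint3; rewrite ?NS //.
    - exact: subset_trans (subsetIl _ _) (NS v).
    - by rewrite dN // esym.
    - by apply: disjointWr (subsetIl _ _) _; rewrite dN // esym.
    - by apply: disjointWr (subsetIr _ _) _; rewrite dN // esym.
  have h3 : (#|N v :\: (N a :|: N b)| + #|N a| + #|N b| <= #|S|)%N.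
    apply: card_disjoint3; rewrite ?NS //.
    - exact: subset_trans (subsetDl _ _) (NS v).
    - by rewrite disjoints_subset setDE (subset_trans (subsetIr _ _)) // setCS subsetUl.
    - by rewrite disjoints_subset setDE (subset_trans (subsetIr _ _)) // setCS subsetUr.
    - by rewrite dN.
  have h4 : (#|N v| <= #|N v :&: N a| + #|N v :&: N b| + #|N v :\: (N a :|: N b)|)%N.
    rewrite -(cardsID (N a :|: N b) (N v)) leq_add2r setIUr cardsU.
    exact: leq_subr.
  have := (Ndeg _ pS, Ndeg _ qS, Ndeg _ vS, (Ndeg _ aS, Ndeg _ bS)).
  move: h1 h2 h3 h4.
  move: #|N p| #|N q| #|N v| #|N a| #|N b| #|S| #|N v :&: N a| #|N v :&: N b| #|_ :\: _|.
  move=> ? ? ? ? ? ? ? ? ? h1 h2 h3 h4 [[[k1 k2] k3] [k4 k5]].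
  by clear -h1 h2 h3 h4 k1 k2 k3 k4 k5; lia.
have no_three u v w : u \in S -> v \in S -> w \in S -> e u v ->
    [disjoint N u & N w] -> [disjoint N v & N w] -> False.
  move=> uS vS wS euv duw dvw.
  have := card_disjoint3 _ _ _ _ (NS u) (NS v) (NS w) (dN _ _ uS vS euv) duw dvw.
  have := (Ndeg _ uS, Ndeg _ vS, Ndeg _ wS).
  move: #|N u| #|N v| #|N w| #|S| => ? ? ? ? [[k1 k2] k3] h.
  by clear -k1 k2 k3 h; lia.
exists [set v in S | [disjoint N v & N a]]; split.
  by apply/subsetP => v; rewrite inE => /andP[].
move=> u v uS vS euv; rewrite !inE uS vS /=.
have [du|ndu] := boolP [disjoint N u & N a];
  have [dv|ndv] := boolP [disjoint N v & N a] => //.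
  by case: (no_three u v a).
have db x : x \in S -> ~~ [disjoint N x & N a] -> [disjoint N x & N b].
  move=> xS; rewrite -setI_eq0 => /set0Pn[p px].
  rewrite -setI_eq0; apply/negPn/negP => /set0Pn[q qx].
  exact: (no_mixed x p q).
by case: (no_three u v b) => //; apply: db.
Qed.

Lemma induced_bipartiteW U S : U \subset S ->
  induced_bipartite e S -> induced_bipartite e U.
Proof.
move=> sUS [A [_ hA]]; exists (A :&: U); split; first exact: subsetIr.
move=> u v uU vU euv; rewrite !inE uU vU !andbT.
by apply: hA => //; apply: (subsetP sUS).
Qed.

Lemma dvol_bipartite S : induced_bipartite e S -> (2 * dvol e S <= #|S| ^ 2)%N.
Proof.
case=> A [sAS hA].
have cS : #|S| = (#|A| + #|S :\: A|)%N.
  by rewrite -(cardsID A S) (setIidPr sAS).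
have hdA v : v \in A -> (ind_deg e S v <= #|S :\: A|)%N.
  move=> vA; apply/subset_leq_card/subsetP => u; rewrite !inE => /andP[uS evu].
  by have := hA _ _ (subsetP sAS _ vA) uS evu; rewrite vA uS andbT; case: (u \in A).
have hdB v : v \in S :\: A -> (ind_deg e S v <= #|A|)%N.
  rewrite inE => /andP[vA vS]; apply/subset_leq_card/subsetP => u.
  rewrite !inE => /andP[uS evu].
  by have := hA _ _ vS uS evu; rewrite (negbTE vA); case: (u \in A).
have : (dvol e S <= #|A| * #|S :\: A| + #|S :\: A| * #|A|)%N.
  rewrite /dvol (big_setID A) (setIidPr sAS); apply: leq_add.
    by rewrite -sum_nat_const; apply: leq_sum.
  by rewrite -sum_nat_const; apply: leq_sum.
rewrite cS -mulnn; move: #|A| #|S :\: A| (dvol e S) => x y z h.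
by have := (nat_Cauchy x y).1; rewrite -!mulnn mulnDl !mulnDr; clear -h; lia.
Qed.

End Bipartite.

(** * Sizes of books whose degree sums are at most [B] *)

Section Books.
Context {R : realType} {n : nat} {e : rel 'I_n}.
Context (esym : symmetric e) (B : R).
Context (HB : forall a b, e a b -> \sum_(w in cnbr e a b) (deg e w)%:R <= B).
Implicit Types (S U W X L : {set 'I_n}) (a b c u v w x : 'I_n).

Lemma ind_degR S v : (ind_deg e S v)%:R = \sum_(u in S | e v u) 1 :> R.
Proof.
rewrite ind_degE natr_sum big_mkcondr; apply: eq_bigr => u _.
by case: (e v u).
Qed.

Lemma degR v : (deg e v)%:R = \sum_(u | e v u) 1 :> R.
Proof. by rewrite /deg ind_degR; apply: eq_bigl => u; rewrite inE. Qed.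

Lemma dvolR S : (dvol e S)%:R = \sum_(a in S) \sum_(b in S | e a b) 1 :> R.
Proof. by rewrite /dvol natr_sum; apply: eq_bigr => a _; rewrite ind_degR. Qed.

Lemma dvolTR : (dvol e setT)%:R = \sum_a \sum_(b | e a b) 1 :> R.
Proof.
rewrite dvolR; apply: eq_big => [a|a _]; first by rewrite inE.
by apply: eq_bigl => b; rewrite inE.
Qed.

Lemma edge_sumC (P : pred 'I_n) (F : 'I_n -> 'I_n -> R) :
  \sum_(a | P a) \sum_(b | P b && e a b) F a b =
  \sum_(a | P a) \sum_(b | P b && e a b) F b a.
Proof.
rewrite (exchange_big_dep P) /= => [|a b _ /andP[] //].
by apply: eq_bigr => b Pb; apply: eq_bigl => a; rewrite Pb esym.
Qed.

Lemma book_card_le S a b (D : R) : e a b ->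
  (forall w, w \in S -> D <= (ind_deg e S w)%:R) ->
  D * #|S :&: cnbr e a b|%:R <= B.
Proof.
move=> eab hD; apply: le_trans (HB _ _ eab).
rewrite mulr_natr -sumr_const big_mkcond [leRHS]big_mkcond /=.
apply: ler_sum => w _; rewrite !inE.
case wS : (w \in S) => /=; last by case: ifP.
case: ifP => // _; apply: le_trans (hD _ wS) _.
by rewrite ler_nat leq_ind_deg // subsetT.
Qed.

Lemma card_cnbr S a b :
  #|S :&: cnbr e a b|%:R = \sum_(u in S) ((e a u)%:R * (e b u)%:R) :> R.
Proof.
rewrite -sum1_card natr_sum big_mkcond [RHS]big_mkcond /=.
apply: eq_bigr => u _; rewrite !inE.
by case: (u \in S); case: (e a u); case: (e b u); rewrite /= ?(mulr0, mulr1).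
Qed.

Lemma ind_deg_sumR S v : (ind_deg e S v)%:R = \sum_(u in S) (e v u)%:R :> R.
Proof. by rewrite ind_degE natr_sum. Qed.

(** Inclusion-exclusion: [p + q + r <= 1 + pq + pr + qr] for bits, so the three books have at least
    [3 D - |S|] vertices of [S] in total, while each has at most [B / D]. *)
Lemma triangle_book S a b c (D : R) : a \in S -> b \in S -> c \in S ->
  e a b -> e a c -> e b c -> 0 <= D ->
  (forall w, w \in S -> D <= (ind_deg e S w)%:R) ->
  D * (3 * D - #|S|%:R) <= 3 * B.
Proof.
move=> aS bS cS eab eac ebc D0 hD.
have hab := book_card_le S a b D eab hD.
have hac := book_card_le S a c D eac hD.
have hbc := book_card_le S b c D ebc hD.
have key : (ind_deg e S a)%:R + (ind_deg e S b)%:R + (ind_deg e S c)%:R <=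
    #|S|%:R + (#|S :&: cnbr e a b|%:R + #|S :&: cnbr e a c|%:R
      + #|S :&: cnbr e b c|%:R) :> R.
  rewrite !card_cnbr !ind_deg_sumR -sum1_card natr_sum -!big_split /=.
  apply: ler_sum => u _.
  by case: (e a u); case: (e b u); case: (e c u); rewrite /= !(mulr0, mulr1, mul0r); lra.
have := (hD _ aS, hD _ bS, hD _ cS).
move: hab hac hbc key.
move: #|S|%:R #|_ :&: _|%:R #|_ :&: _|%:R #|_ :&: _|%:R => s x y z.
move: (ind_deg _ _ _)%:R (ind_deg _ _ _)%:R (ind_deg _ _ _)%:R => da db dc.
move=> hx hy hz key [[ha hb] hc].
have : D * (3 * D - s) <= D * (x + y + z) by rewrite ler_wpM2l //; lra.
lra.
Qed.

(* Some edge of [S] has degree sum at least its average [2 dvol S / |S|], and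
   hence a large book. *)
Lemma dvol_book S (D : R) : 0 <= B -> 0 <= D ->
  (forall w, w \in S -> D <= (ind_deg e S w)%:R) ->
  2 * D * (dvol e S)%:R <= #|S|%:R * (D * #|S|%:R + B).
Proof.
move=> B0 D0 hD.
pose d v : R := (ind_deg e S v)%:R.
have edgeS a b : a \in S -> b \in S -> e a b ->
    D * (d a + d b) <= D * #|S|%:R + B.
  move=> aS bS eab; have hab := book_card_le S a b D eab hD.
  have key : d a + d b <= #|S|%:R + #|S :&: cnbr e a b|%:R.
    rewrite /d card_cnbr !ind_deg_sumR -sum1_card natr_sum -!big_split /=.
    apply: ler_sum => u _.
    by case: (e a u); case: (e b u); rewrite /= !(mulr0, mulr1, mul0r); lra.
  apply: le_trans (_ : D * (#|S|%:R + #|S :&: cnbr e a b|%:R) <= _).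
    exact: ler_wpM2l.
  by rewrite mulrDr lerD2l.
set q : R := (dvol e S)%:R; set s : R := #|S|%:R.
have qE : q = \sum_(a in S) d a by rewrite /q /dvol natr_sum.
have sqE : D * (2 * \sum_(a in S) d a ^+ 2) <= q * (D * s + B).
  have -> : 2 * \sum_(a in S) d a ^+ 2 =
      \sum_(a in S) \sum_(b in S | e a b) (d a + d b).
    under [RHS]eq_bigr do rewrite big_split.
    rewrite big_split /= [X in _ = _ + X]edge_sumC mulr2n mulrDl mul1r.
    by congr (_ + _); apply: eq_bigr => a _;
      rewrite expr2 {2}/d ind_degR mulr_sumr; apply: eq_bigr => b _; rewrite mulr1.
  rewrite /q dvolR mulr_suml mulr_sumr; apply: ler_sum => a aS.
  rewrite mulr_suml mulr_sumr; apply: ler_sum => b /andP[bS eab].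
  by rewrite mul1r edgeS.
have cauchy : q ^+ 2 <= s * \sum_(a in S) d a ^+ 2.
  have : 0 <= \sum_(a in S) (s * d a - q) ^+ 2.
    by apply: sumr_ge0 => a _; apply: sqr_ge0.
  under eq_bigr => a _ do rewrite sqrrB exprMn -mulr_natl.
  rewrite big_split sumrB /= -mulr_sumr.
  have -> : \sum_(i in S) 2%:R * (s * d i * q) = 2 * s * q * q.
    by rewrite -!mulr_sumr -mulr_suml -mulr_sumr -qE; ring.
  rewrite sumr_const -mulr_natr -/s.
  have [s0|sN0] := eqVneq s 0.
    by move=> _; rewrite qE /s; move/eqP: s0; rewrite pnatr_eq0 cards_eq0 => /eqP->;
      rewrite !big_set0 expr0n mulr0.
  have s0 : 0 < s by rewrite lt_neqAle eq_sym sN0 ler0n.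
  move: (\sum_(i in S) _) => z h.
  rewrite -(ler_pM2l s0); lra.
have [q0|qN0] := eqVneq q 0.
  by rewrite q0 mulr0 mulr_ge0 ?ler0n // addr_ge0 ?mulr_ge0 ?ler0n //.
have q0 : 0 < q by rewrite lt_neqAle eq_sym qN0 ler0n.
have s0 : 0 <= s by rewrite ler0n.
rewrite -(ler_pM2l q0).
move: (\sum_(a in S) _) sqE cauchy => z sqE cauchy.
have h1 : D * q ^+ 2 <= D * (s * z) by rewrite ler_wpM2l.
have h2 : s * (D * (2 * z)) <= s * (q * (D * s + B)) by rewrite ler_wpM2l.
lra.
Qed.

End Books.

(** * The eigenvalue inequality summed over edges *)

(* The absolute value of an eigenvector is only a sub-eigenvector, which is all
   that is needed; no Perron-Frobenius theory enters. *)
Lemma nonneg_subeigenvector (R : realType) (n : nat) (e : rel 'I_n) (mu : R) :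
  symmetric e -> 0 < mu -> eigenvalue (adjmx R e) mu ->
  exists (y : 'I_n -> R) (u0 : 'I_n),
    [/\ forall u, 0 <= y u, forall u, mu * y u <= \sum_(v | e u v) y v,
        forall u, y u <= y u0 & 0 < y u0].
Proof.
move=> esym mu0 /eigenvalueP[z zA z0].
pose y u := `|z 0 u|.
have [u1 u1P] : exists u, 0 < y u.
  by have /rV0Pn[u zu] := z0; exists u; rewrite normr_gt0.
have [u0 u0P] : exists u0, forall u, y u <= y u0.
  by case: (@arg_maxP _ _ _ u1 xpredT y isT) => u0 _ h; exists u0 => u; apply: h.
exists y, u0; split=> // [u|u|]; first exact: normr_ge0.
  have <- : `|(mu *: z) 0 u| = mu * y u by rewrite mxE normrM gtr0_norm.
  rewrite -zA mxE [leRHS]big_mkcond; apply: le_trans (ler_norm_sum _ _ _) _.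
  apply: ler_sum => v _; rewrite mxE esym.
  by case: (e u v); rewrite ?mulr1 ?mulr0 ?normr0.
exact: lt_le_trans u1P (u0P u1).
Qed.

Section Spectral.
Context {R : realType} {n : nat} {e : rel 'I_n}.
Context (esym : symmetric e) (B : R).
Context (HB : forall a b, e a b -> \sum_(w in cnbr e a b) (deg e w)%:R <= B).
Context (mu M : R) (y : 'I_n -> R) (mu0 : 0 < mu) (M0 : 0 < M).
Context (y0 : forall u, 0 <= y u).
Context (ymu : forall u, mu * y u <= \sum_(v | e u v) y v).
Context (yM : forall u, y u <= M).
Implicit Types (S U W X L : {set 'I_n}) (a b c u v w x : 'I_n).

Let bookw a b : R := \sum_(w in cnbr e a b) y w.

(** Let [s u] be the weight of the neighbours of [u]. Inclusion-exclusion gives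
    [s a + s b <= Y + bookw a b] on each edge. Over ordered edges the left side sums to
    [2 \sum deg a * s a], which is at least [2 mu \sum deg a * y a = 2 mu \sum s a >= 2 mu^2 Y]. *)
Lemma walk_ineq :
  2 * mu ^+ 2 * (\sum_u y u) <=
  (dvol e setT)%:R * (\sum_u y u) + \sum_a \sum_(b | e a b) bookw a b.
Proof.
set Y := \sum_u y u; pose s u := \sum_(v | e u v) y v.
have edge a b : e a b -> s a + s b <= Y + bookw a b.
  move=> eab; rewrite /s /Y /bookw big_mkcond [X in _ + X <= _]big_mkcond.
  rewrite [X in _ <= _ + X]big_mkcond -!big_split /=.
  apply: ler_sum => u _; rewrite inE; have := y0 u.
  by case: (e a u); case: (e b u) => /=; lra.
have sumC (F : 'I_n -> 'I_n -> R) :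
    \sum_a \sum_(b | e a b) F a b = \sum_a \sum_(b | e a b) F b a.
  exact: (edge_sumC esym xpredT).
have h1 : \sum_a \sum_(b | e a b) (s a + s b) = 2 * \sum_a (deg e a)%:R * s a.
  under eq_bigr do rewrite big_split.
  rewrite big_split /= [X in _ + X]sumC mulr2n mulrDl mul1r.
  by congr (_ + _); apply: eq_bigr => a _; rewrite degR mulr_suml;
    apply: eq_bigr => b _; rewrite mul1r.
have h2 : mu * \sum_a (deg e a)%:R * y a <= \sum_a (deg e a)%:R * s a.
  rewrite mulr_sumr; apply: ler_sum => a _.
  by rewrite mulrCA ler_wpM2l ?ler0n.
have h3 : \sum_a (deg e a)%:R * y a = \sum_a s a.
  rewrite /s sumC; apply: eq_bigr => a _.
  by rewrite degR mulr_suml; apply: eq_bigr => b _; rewrite mul1r.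
have h4 : mu * Y <= \sum_a s a by rewrite mulr_sumr; apply: ler_sum.
have h5 : mu * (mu * Y) <= mu * \sum_a s a by rewrite ler_pM2l.
have h6 : \sum_a \sum_(b | e a b) (s a + s b) <=
    (dvol e setT)%:R * Y + \sum_a \sum_(b | e a b) bookw a b.
  rewrite dvolTR mulr_suml -big_split /=; apply: ler_sum => a _.
  rewrite mulr_suml -big_split /=; apply: ler_sum => b eab.
  by rewrite mul1r edge.
apply: le_trans h6; rewrite h1; move: h2 h5; rewrite h3; lra.
Qed.

(** Each weight satisfies [y w <= M * deg w / mu], which turns the degree bound [B] into a weight
    bound. *)
Lemma bookw_le a b : e a b -> bookw a b <= M * B / mu.
Proof.
move=> eab; rewrite ler_pdivlMr // mulrC.
apply: le_trans (_ : M * \sum_(w in cnbr e a b) (deg e w)%:R <= _).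
  rewrite !mulr_sumr; apply: ler_sum => w _; apply: le_trans (ymu w) _.
  by rewrite degR mulr_sumr; apply: ler_sum => u _; rewrite mulr1.
by rewrite ler_wpM2l ?HB // ltW.
Qed.

Lemma bookw_sum_le :
  \sum_a \sum_(b | e a b) bookw a b <= (dvol e setT)%:R * (M * B / mu).
Proof.
rewrite dvolTR mulr_suml; apply: ler_sum => a _.
rewrite mulr_suml; apply: ler_sum => b eab.
by rewrite mul1r bookw_le.
Qed.

(* When [S] is triangle-free, every triangle meets the complement of [S], so
   that the total weight of the books is linear in the number of edges not
   inside [S]. *)
Lemma bookw_sum_triangle_free S (D : R) : 0 <= B -> 0 < D ->
  (forall w, w \in S -> D <= (ind_deg e S w)%:R) ->
  (forall a b c, a \in S -> b \in S -> c \in S ->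
    e a b -> e a c -> e b c -> False) ->
  \sum_a \sum_(b | e a b) bookw a b <=
  ((dvol e setT)%:R - (dvol e S)%:R) * (M * B / mu + M * B / (2 * D)).
Proof.
move=> B0 D0 hD noT.
(* There are [2x + z] ordered edges not inside [S]. *)
pose x : R := \sum_(a in S) \sum_(w in ~: S | e a w) 1.
pose z : R := \sum_(a in ~: S) \sum_(b in ~: S | e a b) 1.
have z0 : 0 <= z by do 2!apply: sumr_ge0 => ? _.
have splitE (F : 'I_n -> 'I_n -> R) :
    \sum_a \sum_(b | e a b) F a b =
    \sum_(a in S) \sum_(b in S | e a b) F a b +
    (\sum_(a in S) \sum_(b in ~: S | e a b) F a b +
     \sum_(a in S) \sum_(b in ~: S | e a b) F b a +
     \sum_(a in ~: S) \sum_(b in ~: S | e a b) F a b).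
  have inner (P : pred 'I_n) : \sum_(a | P a) \sum_(b | e a b) F a b =
      \sum_(a | P a) \sum_(b in S | e a b) F a b +
      \sum_(a | P a) \sum_(b in ~: S | e a b) F a b.
    rewrite -big_split; apply: eq_bigr => a _ /=.
    rewrite (bigID (fun b => b \in S)) /=; congr (_ + _).
      by apply: eq_bigl => b; rewrite andbC.
    by apply: eq_bigl => b; rewrite andbC inE.
  rewrite (bigID (fun a => a \in S)) /= !inner -!addrA; congr (_ + (_ + _)).
  congr (_ + _); last by apply: eq_bigl => a; rewrite inE.
  rewrite (exchange_big_dep (fun b => b \in S)) /= => [|a b _ /andP[] //].
  apply: eq_bigr => b bS; apply: eq_bigl => a.
  by rewrite bS inE esym.
have qE : (dvol e setT)%:R - (dvol e S)%:R = x + x + z.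
  by rewrite dvolTR dvolR splitE addrC addKr.
(* The book of an edge [ab] inside [S] lies outside [S]. Summing over the crossing edge [aw] first,
   [b] ranges over at most [B / D] common neighbours in [S]. Spread over the [2x] ordered crossing
   edges, this costs [M * B / (2 * D)] each. *)
have inS : \sum_(a in S) \sum_(b in S | e a b) bookw a b <= x * (M * B / D).
  apply: le_trans (_ : \sum_(a in S) \sum_(b in S | e a b)
      \sum_(w in ~: S | e a w && e b w) M <= _).
    apply: ler_sum => a aS; apply: ler_sum => b /andP[bS eab].
    rewrite /bookw big_mkcond [leRHS]big_mkcond /=; apply: ler_sum => w _.
    rewrite !inE; case: ifP => [/andP[ew ew']|_]; last by rewrite andbF.
    rewrite andbT; case: ifPn => [_|]; first exact: yM.
    by rewrite negbK => wS; case: (noT a b w).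
  rewrite mulr_suml; apply: ler_sum => a aS; rewrite mulr_suml.
  rewrite (exchange_big_dep (fun w => (w \in ~: S) && e a w)) /=; last first.
    by move=> b w _ /and3P[-> ->].
  apply: ler_sum => w /andP[wS eaw]; rewrite mul1r.
  have := book_card_le _ HB S a w D eaw hD.
  rewrite mulrC -ler_pdivlMr // => h.
  rewrite -mulrA; apply: le_trans (ler_wpM2l (ltW M0) h).
  rewrite mulr_natr -sumr_const big_mkcond [leRHS]big_mkcond /=.
  apply: ler_sum => b _; rewrite !inE (esym w).
  move: wS; rewrite inE => wS; rewrite wS eaw /=.
  by rewrite -andbA; case: ifP.
have hxS (F : 'I_n -> 'I_n -> R) (P Q : {set 'I_n}) :
    (forall a b, e a b -> F a b <= M * B / mu) ->
    \sum_(a in P) \sum_(b in Q | e a b) F a b <=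
    (\sum_(a in P) \sum_(b in Q | e a b) 1) * (M * B / mu).
  move=> hF; rewrite mulr_suml; apply: ler_sum => a _.
  rewrite mulr_suml; apply: ler_sum => b /andP[_ eab].
  by rewrite mul1r hF.
have bwC a b : e a b -> bookw b a <= M * B / mu by rewrite esym; apply: bookw_le.
rewrite splitE qE.
have h1 := hxS bookw S (~: S) bookw_le.
have h2 := hxS (fun a b => bookw b a) S (~: S) bwC.
have h3 := hxS bookw (~: S) (~: S) bookw_le.
move: h1 h2 h3; rewrite -/x -/z => h1 h2 h3.
have h4 : 0 <= z * (M * B / (2 * D)).
  by rewrite mulr_ge0 // divr_ge0 // mulr_ge0 // ltW.
have -> : (x + x + z) * (M * B / mu + M * B / (2 * D)) =
   x * (M * B / D) + (x * (M * B / mu) + x * (M * B / mu) + z * (M * B / mu))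
   + z * (M * B / (2 * D)).
  by field; rewrite !gt_eqF.
lra.
Qed.

End Spectral.

(** * Lower bounds on the number of edges in terms of [mu] *)

Section EdgeBounds.
Context {R : realType} {n : nat} {e : rel 'I_n}.
Context (esym : symmetric e) (B mu : R).
Context (HB : forall a b, e a b -> \sum_(w in cnbr e a b) (deg e w)%:R <= B).
Context (B0 : 0 <= B) (mu0 : 0 < mu) (emu : eigenvalue (adjmx R e) mu).

(** The eigenvalue inequality at a heaviest vertex bounds the maximal weight by [Y / mu], after
    which the total weight [Y] cancels from [walk_ineq]. *)
Lemma dvol_ge_eigenvalue :
  2 * mu ^+ 2 <= (dvol e setT)%:R * (1 + B / mu ^+ 2).
Proof.
have [y [u0 [y0 ymu yM M0]]] := nonneg_subeigenvector R n e mu esym mu0 emu.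
have Y0 : 0 < \sum_u y u.
  by rewrite (bigD1 u0) //= ltr_wpDr // sumr_ge0.
have MY : y u0 <= (\sum_u y u) / mu.
  rewrite ler_pdivlMr // mulrC; apply: le_trans (ymu u0) _.
  by rewrite big_mkcond; apply: ler_sum => u _; case: ifP.
have h1 := walk_ineq esym mu y mu0 y0 ymu.
have h2 := bookw_sum_le B HB mu (y u0) y mu0 M0 ymu yM.
have h3 : (dvol e setT)%:R * (y u0 * B / mu) <=
    (dvol e setT)%:R * ((\sum_u y u) / mu * B / mu) :> R.
  by rewrite ler_wpM2l ?ler0n // ler_pdivrMr // mulfVK ?gt_eqF // ler_wpM2r.
rewrite -(ler_pM2r Y0); apply: le_trans h1 _.
apply: le_trans (lerD (lexx _) (le_trans h2 h3)) _.
rewrite le_eqVlt; apply/orP; left; apply/eqP; field.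
by rewrite gt_eqF.
Qed.

(** The maximal weight is eliminated in the same way, but the error is charged only to edges not
    inside [S]. *)
Lemma dvol_ge_eigenvalue_triangle_free (S : {set 'I_n}) (D : R) : 0 < D ->
  (forall w, w \in S -> D <= (ind_deg e S w)%:R) ->
  (forall a b c, a \in S -> b \in S -> c \in S ->
    e a b -> e a c -> e b c -> False) ->
  2 * mu ^+ 2 <= (dvol e setT)%:R +
    ((dvol e setT)%:R - (dvol e S)%:R) * (B / mu ^+ 2 + B / (2 * D * mu)).
Proof.
move=> D0 hD noT.
have [y [u0 [y0 ymu yM M0]]] := nonneg_subeigenvector R n e mu esym mu0 emu.
have Y0 : 0 < \sum_u y u.
  by rewrite (bigD1 u0) //= ltr_wpDr // sumr_ge0.
have MY : y u0 <= (\sum_u y u) / mu.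
  rewrite ler_pdivlMr // mulrC; apply: le_trans (ymu u0) _.
  by rewrite big_mkcond; apply: ler_sum => u _; case: ifP.
have h1 := walk_ineq esym mu y mu0 y0 ymu.
have h2 := bookw_sum_triangle_free esym B HB mu (y u0) y mu0 M0 ymu yM S D B0 D0 hD noT.
have C0 : 0 <= ((dvol e setT)%:R - (dvol e S)%:R) * (B / mu + B / (2 * D)).
  apply: mulr_ge0; first by rewrite subr_ge0 ler_nat dvol_mono ?subsetT.
  by rewrite addr_ge0 // divr_ge0 // ?mulr_ge0 // ltW.
have h3 := ler_wpM2r C0 MY.
rewrite -(ler_pM2r Y0); apply: le_trans h1 _.
rewrite mulrDl lerD2l; apply: le_trans h2 _.
have -> : ((dvol e setT)%:R - (dvol e S)%:R) *
    (y u0 * B / mu + y u0 * B / (2 * D)) =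
    y u0 * (((dvol e setT)%:R - (dvol e S)%:R) * (B / mu + B / (2 * D))) :> R.
  by field; rewrite !gt_eqF.
apply: le_trans h3 _.
rewrite le_eqVlt; apply/orP; left; apply/eqP; field.
by rewrite !gt_eqF.
Qed.

End EdgeBounds.

(** * Construction of the bipartite subgraph, and the dichotomy *)

(* The constants: [43/100] is a minimum degree density just above the [3/7] of
   [bipartite_of_triangle_free], and [429/1000] absorbs the lower-order term
   of [min_deg_subset]. *)
Lemma rough_bipartite (R : realType) (n : nat) (e : rel 'I_n) (mu theta : R) :
  symmetric e -> irreflexive e ->
  (forall a b, e a b ->
    \sum_(w in cnbr e a b) (deg e w)%:R <= 2 / 321 * n%:R ^+ 2 :> R) ->
  0 < theta -> theta < 2 ^- 16 -> 1000 <= n%:R :> R ->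
  eigenvalue (adjmx R e) mu -> (2^-1 - theta) * n%:R < mu ->
  exists S : {set 'I_n},
  [/\ induced_bipartite e S,
      n%:R ^+ 2 - #|S|%:R ^+ 2 <= 40 * theta * n%:R ^+ 2 &
      #|S|%:R ^+ 2 / 2 - 2 * theta * n%:R ^+ 2 <= (dvol e S)%:R].
Proof.
move=> esym eirr HB th0 th1 hn emu hmu.
set N : R := n%:R in hn hmu HB *.
have {}th1 : theta < 1 / 100 / 100.
  by apply: lt_le_trans th1 _; rewrite (exprM _ 8 2); lra.
have mu1 : (1 / 2 - 1 / 100 / 100) * N <= mu.
  apply: ltW; apply: le_lt_trans hmu; rewrite ler_wpM2r; lra.
have mu0 : 0 < mu by lra.
have mu2 : (1 / 4 - theta) * N ^+ 2 <= mu ^+ 2.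
  apply: le_trans (_ : ((2^-1 - theta) * N) ^+ 2 <= _).
    rewrite exprMn ler_wpM2r ?sqr_ge0 //.
    have -> : (2^-1 - theta) ^+ 2 = 1 / 4 - theta + theta ^+ 2 by field.
    by rewrite lerDl sqr_ge0.
  rewrite ler_sqr ?nnegrE; [exact: ltW|rewrite mulr_ge0; lra|exact: ltW].
have NN0 : 0 < N ^+ 2 by rewrite exprn_gt0 //; lra.
have mu3 : (1 / 4 - 1 / 100 / 100) * N ^+ 2 <= mu ^+ 2.
  by apply: le_trans mu2; rewrite ler_wpM2r; lra.
pose B : R := 2 / 321 * N ^+ 2.
have B0 : 0 <= B by rewrite /B; lra.
have Bmu : B / mu ^+ 2 <= 1 / 40.
  by rewrite ler_pdivrMr ?exprn_gt0 // /B; lra.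
have hq := dvol_ge_eigenvalue esym B mu HB B0 mu0 emu.
set q : R := (dvol e setT)%:R in hq.
have q0 : 0 <= q by rewrite ler0n.
have q1 : 487 / 1000 * N ^+ 2 <= q.
  have : q * (1 + B / mu ^+ 2) <= q * (1 + 1 / 40) by rewrite ler_wpM2l //; lra.
  lra.
have [S [_ maxS degS]] := min_deg_subset e esym eirr R (43 / 100) setT.
move: maxS; rewrite cardsT card_ord -/N -/q => maxS.
set s : R := #|S|%:R in maxS degS *; set qS : R := (dvol e S)%:R in maxS *.
have s0 : 0 <= s by rewrite ler0n.
have qSs : qS <= s ^+ 2 by rewrite /qS /s -natrX ler_nat dvol_le.
have ss1 : 9 / 100 * N ^+ 2 <= s ^+ 2 by clear -maxS qSs q1 NN0; lra.
have s1 : 3 / 10 * N <= s.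
  rewrite -ler_sqr ?nnegrE //; last by clear -hn; lra.
  by rewrite exprMn; clear -ss1; lra.
(* Since [s >= 300], the loss [43/200] in the degree bound is below [s / 1000]. *)
pose D : R := 429 / 1000 * s.
have D0 : 0 < D by rewrite /D; clear -s1 hn; lra.
have hD w : w \in S -> D <= (ind_deg e S w)%:R.
  by move=> /degS; rewrite /D; clear -s1 hn; lra.
(* Bootstrap: the trivial [dvol S <= s^2] gave only [s >= 3/10 N]; a bound near [s^2 / 2] now
   improves this to [842/1000 N]. *)
have qS1 := dvol_book esym B HB S D B0 (ltW D0) hD.
rewrite -/s -/qS in qS1.
have s_gt0 : 0 < s by clear -s1 hn; lra.
have qS2 : 2 * (429 / 1000) * qS <= 429 / 1000 * s ^+ 2 + B.
  by rewrite -(ler_pM2l s_gt0); move: qS1; rewrite /D; clear; lra.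
have ss2 : 71 / 100 * N ^+ 2 <= s ^+ 2 by move: qS2; rewrite /B; clear -maxS q1 NN0; lra.
have s2 : 842 / 1000 * N <= s.
  rewrite -ler_sqr ?nnegrE //; last by clear -hn; lra.
  by rewrite exprMn; clear -ss2 NN0; lra.
have noT a b c : a \in S -> b \in S -> c \in S -> e a b -> e a c -> e b c -> False.
  move=> aS bS cS eab eac ebc.
  have := triangle_book B HB S a b c D aS bS cS eab eac ebc (ltW D0) hD.
  by rewrite -/s /D /B; clear -ss2 NN0; lra.
have bip : induced_bipartite e S.
  apply: (bipartite_of_triangle_free e esym) noT _ => v vS.
  have := hD _ vS; rewrite -(ltr_nat R) !natrM -/s /D.
  by move: (ind_deg _ _ _)%:R => d hd; clear -hd s_gt0; lra.
have qS3 : 2 * qS <= s ^+ 2.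
  by rewrite /qS /s -natrX -natrM ler_nat dvol_bipartite.
have Dmu : B / (2 * D * mu) <= 175 / 100 / 100.
  rewrite ler_pdivrMr; last by rewrite mulr_gt0 // mulr_gt0.
  have : 36 / 100 * N * ((1 / 2 - 1 / 100 / 100) * N) <= D * mu.
    by apply: ler_pM; rewrite /D; clear -s2 hn mu1; lra.
  by rewrite /B; clear -NN0; lra.
have hq2 := dvol_ge_eigenvalue_triangle_free esym B mu HB B0 mu0 emu S D D0 hD noT.
rewrite -/q -/qS in hq2.
have qqS : 0 <= q - qS by rewrite subr_ge0 ler_nat dvol_mono ?subsetT.
have hq3 : (q - qS) * (B / mu ^+ 2 + B / (2 * D * mu)) <= (q - qS) * (425 / 100 / 100).
  by rewrite ler_wpM2l //; clear -Bmu Dmu; lra.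
have sN : s <= N by rewrite ler_nat -[leqRHS]card_ord max_card.
have sN2 : s ^+ 2 <= N ^+ 2 by rewrite ler_sqr ?nnegrE // ler0n.
exists S; rewrite -/s -/qS; split=> //.
  (* Maximality gives [q - qS <= 43/100 (N^2 - s^2)], and [qS <= s^2 / 2]. As
     [1/2 - 43/100 * 1.0425 > 1/20], it follows that [(N^2 - s^2) / 20 <= 2 theta N^2]. *)
  by clear -hq2 hq3 maxS qS3 mu2 sN2; lra.
by clear -hq2 hq3 maxS mu2 sN2; lra.
Qed.

Lemma bipartite_min_deg (R : realType) (n : nat) (e : rel 'I_n) (eta : R)
    (S : {set 'I_n}) :
  symmetric e -> irreflexive e -> 0 < eta -> eta < 1 / 40 -> 1 <= eta * n%:R ->
  induced_bipartite e S ->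
  n%:R ^+ 2 - #|S|%:R ^+ 2 <= 40 * eta ^+ 3 * n%:R ^+ 2 ->
  #|S|%:R ^+ 2 / 2 - 2 * eta ^+ 3 * n%:R ^+ 2 <= (dvol e S)%:R ->
  exists U : {set 'I_n},
    [/\ induced_bipartite e U, (1 - 4 * eta) * n%:R < #|U|%:R &
        forall v, v \in U -> (2^-1 - 7 * eta) * n%:R < (ind_deg e U v)%:R].
Proof.
move=> esym eirr eta0 eta1 hn bipS hS1 hS2.
have [U [sUS maxU degU]] := min_deg_subset e esym eirr R (2^-1 - 3 * eta) S.
have bipU := induced_bipartiteW e _ _ sUS bipS.
have qU : 2 * (dvol e U)%:R <= #|U|%:R ^+ 2 :> R.
  by rewrite -natrX -natrM ler_nat dvol_bipartite.
(* The size bound is proved with [1 - eta], since the degree bound is derived from it. *)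
exists U; suff hU : (1 - eta) * n%:R <= #|U|%:R :> R.
  split=> // [|v vU].
    by apply: lt_le_trans hU; clear -hn; lra.
  have := degU v vU; move: hU (ind_deg e U v)%:R.
  move: #|U|%:R n%:R hn => u N hn hu d hd.
  have h1 : (2^-1 - 3 * eta) * (2 * ((1 - eta) * N) - 1) <=
      (2^-1 - 3 * eta) * (2 * u - 1) by rewrite ler_wpM2l; clear -hu eta1; lra.
  have h2 : 0 <= eta * (eta * N) by rewrite mulr_ge0 //; clear -hn eta0; lra.
  by clear -h1 h2 hd hn eta0; lra.
rewrite -ler_sqr ?nnegrE ?ler0n //; last first.
  by rewrite mulr_ge0 ?ler0n //; clear -eta1; lra.
move: hS1 hS2 maxU qU.
move: #|U|%:R #|S|%:R n%:R (dvol e S)%:R (dvol e U)%:R hn => u s N qS qU hn.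
move=> hS1 hS2 maxU hqU.
(* Comparing maximality with [dvol U <= |U|^2 / 2] leaves a common factor [eta]; cancelling it turns
   the error [eta^3] into [eta^2]. *)
have h1 : eta * (3 * s ^+ 2 - 2 * eta ^+ 2 * N ^+ 2) <= eta * (3 * u ^+ 2).
  by clear -hS2 maxU hqU; lra.
have h2 : 3 * s ^+ 2 - 2 * eta ^+ 2 * N ^+ 2 <= 3 * u ^+ 2.
  by move: h1; rewrite ler_pM2l.
have N0 : 0 <= eta * N ^+ 2 by rewrite mulr_ge0 ?sqr_ge0 ?ltW.
have h3 : eta * (eta * N ^+ 2) <= 1 / 40 * (eta * N ^+ 2).
  by rewrite ler_wpM2r // ltW.
have h4 : eta * (eta * (eta * N ^+ 2)) <= 1 / 40 * (eta * (eta * N ^+ 2)).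
  by apply: ler_wpM2r (ltW eta1); rewrite mulr_ge0 // ltW.
by clear -hS1 h2 h3 h4 N0; lra.
Qed.

Theorem theorem2 (R : realType) (theta : R) :
  0 < theta -> theta < 2 ^- 16 ->
  exists n0 : nat, forall (n : nat) (e : rel 'I_n),
    (n0 <= n)%N -> simple_graph e ->
    (exists mu : R, is_mu e mu /\ mu > (2^-1 - theta) * n%:R) ->
    (forall t : nat, (3 <= t)%N -> (t%:R : R) <= n%:R / 321 -> has_cycle_of_length e t)
    \/
    (exists S : {set 'I_n},
       [/\ induced_bipartite e S,
           #|S|%:R > (1 - 4 * powR theta 3^-1) * n%:R &
           forall v, v \in S ->
             (ind_deg e S v)%:R > (2^-1 - 7 * powR theta 3^-1) * n%:R]).
Proof.
move=> th0 th1; set eta := powR theta 3^-1.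
have eta0 : 0 < eta by rewrite powR_gt0.
have eta3 : eta ^+ 3 = theta.
  by rewrite -(powR_mulrn _ (ltW eta0)) -powRrM mulVf ?pnatr_eq0 // powRr1 // ltW.
(* This holds because [40^3 = 64000 < 2^16]. *)
have eta1 : eta < 1 / 40.
  rewrite ltNge; apply/negP => h.
  have h3 : (1 / 40) ^+ 3 <= eta ^+ 3 by rewrite lerXn2r ?nnegrE ?(ltW eta0) //; clear; lra.
  have := le_lt_trans h3 (_ : eta ^+ 3 < 2 ^- 16); rewrite eta3 => /(_ th1).
  by rewrite (exprM _ 8 2); clear; lra.
(* The second summand ensures [eta * n >= 1], which absorbs the lower-order term in the final degree
   bound. *)
exists (1000 + Num.bound eta^-1)%N => n e hn [esym eirr] [mu [[emu _] hmu]].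
have [h|/existsNP[t]] := pselect (forall t : nat, (3 <= t)%N ->
    (t%:R : R) <= n%:R / 321 -> has_cycle_of_length e t); first by left.
move=> /not_implyP[t3 /not_implyP[tn noC]]; right.
have hnR : 1000 + (Num.bound eta^-1)%:R <= n%:R :> R by rewrite -natrD ler_nat.
have hn1 : 1000 <= n%:R :> R by apply: le_trans hnR; rewrite lerDl ler0n.
have hn2 : 1 <= eta * n%:R.
  rewrite mulrC -ler_pdivrMr // div1r.
  apply: le_trans (ltW (archi_boundP _)) _; first by rewrite invr_ge0 ltW.
  by apply: le_trans hnR; rewrite lerDr.
have HB a b : e a b ->
    \sum_(w in cnbr e a b) (deg e w)%:R <= 2 / 321 * n%:R ^+ 2 :> R.
  move=> eab; rewrite -natr_sum.
  apply: le_trans (_ : (2 * t * n)%:R <= _).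
    by rewrite ler_nat (cnbr_deg_sum e esym eirr).
  rewrite !natrM; have := ler_wpM2r (ler0n R n) tn.
  by move: n%:R t%:R => N T; clear; lra.
have [S [bipS hS1 hS2]] :=
  rough_bipartite R n e mu theta esym eirr HB th0 th1 hn1 emu hmu.
apply: (bipartite_min_deg R n e eta S) => //; by rewrite eta3.
Qed.
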